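(* Let $\mathcal{S}=\{x\in\mathbb{R}^n : x^\top x=1\}$, let $k$ be an integer with $1\le k\le n$, and let $f:\mathbb{R}^n\to\mathbb{R}$ be smooth, Lipschitz continuous with parameter $L_f^0\ge 0$, and satisfy for some $L_f\ge 0$ the inequality $f(y)\le f(x)+\langle\nabla f(x),y-x\rangle+\frac{L_f}{2}\|y-x\|^2$ for all $x,y\in\mathbb{R}^n$. Let $\gamma>0$ and consider the two problems $$\text{(Q0)}\quad \min_{x\in\mathcal{S}} f(x)\ \ \text{s.t.}\ \ \|x\|_0\le k,\qquad \text{(Q1)}\quad \min_{x\in\mathcal{S}} f(x)+\gamma\big(\|x\|_1-|||x|||_k\big).$$ If $\gamma>nL_f^0/k$, then (Q0) and (Q1) have the same set of global minimizers. Moreover, any local minimizer of (Q1) is also a local minimizer of (Q0).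
   Context: $\|\cdot\|$ is the Euclidean norm; $\|x\|_0$ is the number of nonzero entries of $x$; $\|x\|_1$ is the $\ell_1$-norm; $|||x|||_k$ is the largest-$k$ norm, i.e. the sum of the $k$ largest values among the absolute values $|x_{(1)}|,\dots,|x_{(n)}|$ of the entries of $x$. A local minimizer of a problem is a feasible point minimizing the objective over the intersection of the feasible set with some neighborhood of that point. *)

(* Defs.v *)
From HB Require Import structures.
From mathcomp Require Import all_boot all_order all_algebra.
From mathcomp Require Import all_classical all_reals all_analysis.

Set Implicit Arguments.
Unset Strict Implicit.
Unset Printing Implicit Defensive.

Import Order.TTheory GRing.Theory Num.Theory.
Import numFieldNormedType.Exports.

Local Open Scope classical_set_scope.
Local Open Scope ring_scope.

(* Vectors of R^n are columns 'cV[R]_n.  The library norm `|x| on 'cV[R]_n is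
   the maximum norm, so the Euclidean norm is defined here; both induce the
   same topology, hence the same neighborhoods and the same (Frechet)
   differentiability. *)

Definition dot (R : realType) (n : nat) (u v : 'cV[R]_n) : R :=
  (u^T *m v) 0 0.

Definition l2norm (R : realType) (n : nat) (x : 'cV[R]_n) : R :=
  Num.sqrt (dot x x).

Definition l1norm (R : realType) (n : nat) (x : 'cV[R]_n) : R :=
  \sum_(i < n) `|x i 0|.

Definition l0norm (R : realType) (n : nat) (x : 'cV[R]_n) : nat :=
  #|[pred i | x i 0 != 0]|.

Definition abs_sorted (R : realType) (n : nat) (x : 'cV[R]_n) : seq R :=
  sort (fun a b => b <= a) [seq `|x i 0| | i <- enum 'I_n].

Definition largest_norm (R : realType) (n k : nat) (x : 'cV[R]_n) : R :=
  \sum_(a <- take k (abs_sorted x)) a.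

Definition unit_sphere (R : realType) (n : nat) : set 'cV[R]_n :=
  [set x | dot x x = 1].
Arguments unit_sphere : clear implicits.

(* The vector of partial derivatives, which represents the differential with
   respect to [dot] at every point where f is differentiable. *)
Definition gradient (R : realType) (n : nat) (f : 'cV[R]_n -> R)
    (x : 'cV[R]_n) : 'cV[R]_n :=
  \col_i 'D_(delta_mx i 0) f x.

(* "Smooth" in the sense usual in first-order optimization: of class C^1. *)
Definition smooth (R : realType) (n : nat) (f : 'cV[R]_n -> R) : Prop :=
  (forall x, differentiable f x) /\ continuous (gradient f).

Definition euclidean_lipschitz (R : realType) (n : nat) (L : R)
    (f : 'cV[R]_n -> R) : Prop :=
  forall x y, `|f x - f y| <= L * l2norm (x - y).

Definition quadratic_upper_bound (R : realType) (n : nat) (L : R)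
    (f : 'cV[R]_n -> R) : Prop :=
  forall x y, f y <= f x + dot (gradient f x) (y - x)
                     + L / 2 * l2norm (y - x) ^+ 2.

Definition global_minimizers (R : realType) (T : Type) (D : set T)
    (g : T -> R) : set T :=
  [set x | D x /\ forall y, D y -> g x <= g y].

Definition local_minimizers (R : realType) (T : topologicalType) (D : set T)
    (g : T -> R) : set T :=
  [set x | D x /\ exists2 U, nbhs x U & forall y, (D `&` U) y -> g x <= g y].

Definition feasible_Q0 (R : realType) (n k : nat) : set 'cV[R]_n :=
  unit_sphere R n `&` [set x | (l0norm x <= k)%N].
Arguments feasible_Q0 : clear implicits.

Definition feasible_Q1 (R : realType) (n : nat) : set 'cV[R]_n :=
  unit_sphere R n.
Arguments feasible_Q1 : clear implicits.

Definition objective_Q1 (R : realType) (n k : nat) (gamma : R)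
    (f : 'cV[R]_n -> R) (x : 'cV[R]_n) : R :=
  f x + gamma * (l1norm x - largest_norm k x).

(* Main.v *)
(** Let [T] carry the [k] largest absolute values of a unit vector [x], so that
    the penalty [p x] is the l1-mass of [x] outside [T].  Multiplying the entries
    outside [T] by [b <= 1] and those in [T] by the [a >= 1] which restores the
    unit norm gives a point of the sphere with penalty [b * p x], at distance at
    most [(1 - b) * sqrt (n / k) * p x] from [x], because the entries in [T] have
    square mass at least [k / n].  The objective of (Q1) therefore drops strictly
    when [p x > 0] and [b < 1]: taking [b] close to 1 shows that local minimizers
    of (Q1) are k-sparse, and [b = 0] compares any point with a k-sparse one. *)
Require Import Defs.
From HB Require Import structures.
From mathcomp Require Import all_boot all_order all_algebra.
From mathcomp Require Import all_classical all_reals all_analysis.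
From mathcomp Require Import ring lra.
Import Order.TTheory GRing.Theory Num.Theory.
Import numFieldNormedType.Exports.
Local Open Scope classical_set_scope.
Local Open Scope ring_scope.

Lemma dotE {R : realType} {n : nat} (u v : 'cV[R]_n) :
  dot u v = \sum_(i < n) u i 0 * v i 0.
Proof. by rewrite /dot mxE; apply: eq_bigr => i _; rewrite mxE. Qed.

Lemma normr_le_l2norm {R : realType} {n : nat} (u : 'cV[R]_n) (i : 'I_n) :
  `|u i 0| <= l2norm u.
Proof.
rewrite -sqrtr_sqr; apply: ler_wsqrtr; rewrite dotE (bigD1 i) //= expr2 lerDl.
by apply: sumr_ge0 => j _; rewrite -expr2 sqr_ge0.
Qed.

Lemma sumr_sqr_le (R : realType) (I : finType) (P : pred I) (F : I -> R) :
  (forall i, 0 <= F i) -> \sum_(i | P i) F i ^+ 2 <= (\sum_(i | P i) F i) ^+ 2.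
Proof.
move=> F0; rewrite [leRHS]expr2 mulr_suml; apply: ler_sum => i Pi.
rewrite expr2 ler_wpM2l // (bigD1 i) //= lerDl.
exact: sumr_ge0.
Qed.

(** A relation and not a chosen set: ties among absolute values allow several such [T], and a
    rescaled vector may keep the same one. *)
Definition top_indices {R : realType} {n : nat} (k : nat) (x : 'cV[R]_n)
    (T : {set 'I_n}) : Prop :=
  #|T| = k /\ forall i j, i \in T -> j \notin T -> `|x j 0| <= `|x i 0|.

Definition penalty {R : realType} {n : nat} (k : nat) (x : 'cV[R]_n) : R :=
  l1norm x - largest_norm k x.

Lemma exists_top_indices {R : realType} {n k : nat} (x : 'cV[R]_n) :
  (k <= n)%N -> exists T, top_indices k x T.
Proof.
move=> kn; pose r (i j : 'I_n) := `|x j 0| <= `|x i 0|.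
have r_tr : transitive r by move=> b a c ab bc; exact: le_trans bc ab.
have r_tot : total r by move=> a b; exact: le_total.
pose s := sort r (enum 'I_n).
have s_size : size s = n by rewrite size_sort size_enum_ord.
have s_uniq : uniq s by rewrite sort_uniq enum_uniq.
have s_mem i : i \in s by rewrite mem_sort mem_enum.
(* Pairwise sortedness splits along the concatenation: every kept index then dominates every dropped
   one. *)
have : pairwise r (take k s ++ drop k s).
  by rewrite cat_take_drop -sorted_pairwise // sort_sorted.
rewrite pairwise_cat => /and3P[/allrelP rel _ _].
exists [set i in take k s]; split=> [|i j].
  by rewrite cardsE (card_uniqP (take_uniq k s_uniq)) size_takel // s_size.
rewrite !inE => iT jT; apply: rel => //.
by have := s_mem j; rewrite -{1}(cat_take_drop k s) mem_cat (negbTE jT).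
Qed.

(** Absolute values on [T] dominate those off [T], so sorting the two groups separately and
    concatenating gives a sorted list. Sorted lists are unique up to permutation, so the first [k]
    entries of [abs_sorted x] come from [T]. *)
Lemma penaltyE {R : realType} {n k : nat} {x : 'cV[R]_n} {T : {set 'I_n}} :
  top_indices k x T -> penalty k x = \sum_(i | i \notin T) `|x i 0|.
Proof.
move=> [Tk Tx]; pose r (a b : R) := b <= a.
have r_tr : transitive r by move=> b a c ab bc; exact: le_trans bc ab.
have r_tot : total r by move=> a b; exact: le_total.
have r_anti : antisymmetric r by move=> a b /andP[? ?]; apply/le_anti/andP.
pose A := [seq `|x i 0| | i <- enum T]; pose B := [seq `|x i 0| | i <- enum (~: T)].
have sortE : abs_sorted x = sort r A ++ sort r B.
  apply: (sorted_eq r_tr r_anti); first exact: sort_sorted.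
    rewrite sorted_pairwise // pairwise_cat -!sorted_pairwise // !sort_sorted //.
    rewrite !andbT; apply/allrelP => a b; rewrite !mem_sort.
    move=> /mapP[i iT ->] /mapP[j jT ->]; rewrite /r.
    by apply: Tx; [rewrite mem_enum in iT | rewrite mem_enum inE in jT].
  rewrite perm_sort perm_sym.
  apply: (@perm_trans _ (A ++ B)); first by apply: perm_cat; rewrite perm_sort.
  rewrite -map_cat; apply: perm_map; apply: uniq_perm.
  - rewrite cat_uniq !enum_uniq andbT; apply/hasPn => i.
    by rewrite !mem_enum inE.
  - exact: enum_uniq.
  - by move=> i; rewrite mem_cat !mem_enum inE orbN.
have lnE : largest_norm k x = \sum_(i in T) `|x i 0|.
  rewrite /largest_norm sortE take_size_cat; last first.
    by rewrite size_sort size_map -cardE.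
  by rewrite (perm_big A) ?perm_sort //= big_map big_enum.
by rewrite /penalty /l1norm lnE (bigID (mem T)) /= addrAC subrr add0r.
Qed.

Lemma penalty_ge0 {R : realType} {n k : nat} (x : 'cV[R]_n) :
  (k <= n)%N -> 0 <= penalty k x.
Proof.
move=> /(exists_top_indices x)[T /penaltyE ->].
exact: sumr_ge0.
Qed.

(** A zero penalty puts the support inside [T]. Conversely, a nonzero entry off [T] forces all
    entries on [T] to be nonzero, which makes at least [k + 1] of them. *)
Lemma penalty_eq0 {R : realType} {n k : nat} (x : 'cV[R]_n) :
  (k <= n)%N -> (penalty k x == 0) = (l0norm x <= k)%N.
Proof.
move=> /(exists_top_indices x)[T xT]; rewrite (penaltyE xT).
have [Tk Tx] := xT; rewrite psumr_eq0 //; apply/allP/idP => [x0|xk i _].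
  rewrite /l0norm -Tk; apply/subset_leq_card/fintype.subsetP => i; rewrite inE => xi.
  apply: contraNT xi => iT; rewrite -normr_eq0.
  by have := x0 i (mem_index_enum i); rewrite iT.
apply/implyP => iT; rewrite normr_eq0; apply: contraLR xk => xi.
rewrite -ltnNge -Tk.
have -> : #|T|.+1 = #|i |: T| by rewrite cardsU1 iT.
apply/subset_leq_card/fintype.subsetP => j; rewrite !inE => /orP[/eqP ->//|jT].
by rewrite -normr_gt0; apply: lt_le_trans (Tx _ _ jT iT); rewrite normr_gt0.
Qed.

(** Summing [x_j^2 <= x_i^2] over all pairs with [i] in [T] and [j] outside bounds [k] times the
    outer mass by [n - k] times the inner one; adding [k] times the inner mass to both sides gives
    the claim. *)
Lemma top_indices_sqr_mass {R : realType} {n k : nat} {x : 'cV[R]_n}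
    {T : {set 'I_n}} : top_indices k x T ->
  k%:R * \sum_(i < n) x i 0 ^+ 2 <= n%:R * \sum_(i in T) x i 0 ^+ 2.
Proof.
move=> [Tk Tx].
have cross : \sum_(i in T) \sum_(j | j \notin T) x j 0 ^+ 2
    <= \sum_(i in T) \sum_(j | j \notin T) x i 0 ^+ 2.
  apply: ler_sum => i iT; apply: ler_sum => j jT.
  by rewrite -[leLHS]real_normK ?num_real // -[leRHS]real_normK ?num_real // lerXn2r ?nnegrE ?Tx.
rewrite sumr_const Tk in cross.
rewrite [leRHS]exchange_big /= sumr_const in cross.
have nE : n%:R = k%:R + #|[predC T]|%:R :> R.
  by rewrite -natrD -Tk cardC card_ord.
rewrite (bigID (mem T)) /= nE.
rewrite -mulr_natl -[leRHS]mulr_natl in cross.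
have -> : #|[predC T]| = #|[pred i | i \notin T]| by apply: eq_card => i.
by rewrite mulrDr mulrDl lerD2l.
Qed.

(** [S] and [C] stand for the square masses on and off [T], and the last bound is on the squared
    displacement. It follows from [a - 1 <= (1 - b) * (C / S)], since [(C / S)^2 * S + C = C / S]
    when [S + C = 1]. *)
Lemma shrink_scalars {R : realType} {S C b : R} :
  0 < S -> 0 <= C -> S + C = 1 -> 0 <= b <= 1 ->
  exists a, [/\ 1 <= a, a ^+ 2 * S + b ^+ 2 * C = 1
    & (a - 1) ^+ 2 * S + (1 - b) ^+ 2 * C <= (1 - b) ^+ 2 * (C / S)].
Proof.
move=> S0 C0 SC /andP[b0 b1].
have bC : b ^+ 2 * C <= C by apply: ler_piMl => //; rewrite expr_le1.
pose q := (1 - b ^+ 2 * C) / S; pose a := Num.sqrt q.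
have q1 : 1 <= q by rewrite ler_pdivlMr // mul1r; lra.
have a1 : 1 <= a by rewrite -sqrtr1; exact: ler_wsqrtr.
have aq : a ^+ 2 * S = 1 - b ^+ 2 * C.
  by rewrite sqr_sqrtr ?(le_trans ler01 q1) // /q divfK ?gt_eqF.
exists a; split=> //; first by rewrite aq; ring.
set d := (1 - b) * (C / S).
have dS : d * S = (1 - b) * C by rewrite /d -mulrA divfK ?gt_eqF.
have d0 : 0 <= d by rewrite mulr_ge0 ?subr_ge0 // divr_ge0 // ltW.
(* From (a - 1)(a + 1) S = (1 - b)(1 + b) C and 1 + b <= 2 <= a + 1. *)
have ad : a - 1 <= d.
  rewrite -(ler_pM2r S0) dS.
  have e : (a - 1) * S * (a + 1) = (1 - b) * C * (1 + b).
    transitivity (a ^+ 2 * S - S); first by ring.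
    by rewrite aq (_ : S = 1 - C); [ring | lra].
  have x0 : 0 <= (1 - b) * C by rewrite mulr_ge0 ?subr_ge0.
  rewrite -(@ler_pM2r _ (a + 1)) ?e; last by lra.
  by rewrite ler_wpM2l //; lra.
have ad2 : (a - 1) ^+ 2 * S <= d ^+ 2 * S.
  by rewrite ler_pM2r // lerXn2r ?nnegrE ?subr_ge0.
have dE : d ^+ 2 * S + (1 - b) ^+ 2 * C = (1 - b) ^+ 2 * (C / S).
  rewrite expr2 -mulrA dS /d.
  rewrite -[C / S in RHS]mulr1 -SC.
  by field; rewrite gt_eqF.
by rewrite -dE lerD2r.
Qed.

Lemma shrink_penalty {R : realType} {n k : nat} {x : 'cV[R]_n} {b : R} :
  (1 <= k <= n)%N -> unit_sphere R n x -> 0 <= b <= 1 ->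
  exists z, [/\ unit_sphere R n z, penalty k z = b * penalty k x
    & l2norm (z - x) <= n%:R / k%:R * ((1 - b) * penalty k x)].
Proof.
move=> /andP[k1 kn]; rewrite /unit_sphere /= dotE => x1 b01.
have [b0 b1] := andP b01.
have [T xT] := exists_top_indices x kn; have [Tk Tx] := xT.
have k0 : 0 < k%:R :> R by rewrite ltr0n.
have c1 : 1 <= n%:R / k%:R :> R by rewrite ler_pdivlMr // mul1r ler_nat.
pose S := \sum_(i in T) x i 0 ^+ 2; pose C := \sum_(i | i \notin T) x i 0 ^+ 2.
have sqE : \sum_(i < n) x i 0 ^+ 2 = 1.
  by rewrite -x1; apply: eq_bigr => i _; rewrite expr2.
have SC : S + C = 1 by rewrite -sqE [RHS](bigID (mem T)).
have := top_indices_sqr_mass xT; rewrite sqE mulr1 -/S => kS.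
have n0 : 0 < n%:R :> R by rewrite ltr0n (leq_trans k1).
have S0 : 0 < S by rewrite -(pmulr_rgt0 _ n0); exact: lt_le_trans k0 kS.
have C0 : 0 <= C by apply: sumr_ge0 => i _; exact: sqr_ge0.
have [a [a1 abSC dist]] := shrink_scalars S0 C0 SC b01.
have a0 : 0 <= a by exact: le_trans a1.
pose z : 'cV[R]_n := \col_i ((if i \in T then a else b) * x i 0).
have zE i : z i 0 = (if i \in T then a else b) * x i 0 by rewrite mxE.
exists z; split.
- rewrite /unit_sphere /= dotE -abSC (bigID (mem T)) /= !mulr_sumr.
  by congr (_ + _); apply: eq_bigr => i iT; rewrite zE ?iT ?(negbTE iT); ring.
(* The same [T] serves for [z], because [b <= a] preserves the domination. *)
- rewrite (penaltyE xT) (@penaltyE _ _ _ _ T); last first.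
    split=> // i j iT jT; rewrite !zE iT (negbTE jT) !normrM (ger0_norm a0) (ger0_norm b0).
    by apply: ler_pM => //; [exact: le_trans b1 a1 | exact: Tx].
  rewrite mulr_sumr; apply: eq_bigr => i iT.
  by rewrite zE (negbTE iT) normrM (ger0_norm b0).
- have p0 := penalty_ge0 x kn.
  have w0 : 0 <= (1 - b) * penalty k x by rewrite mulr_ge0 // subr_ge0.
  have y0 : 0 <= n%:R / k%:R * ((1 - b) * penalty k x).
    by rewrite mulr_ge0 // (le_trans ler01).
  rewrite -[leRHS]ger0_norm // -sqrtr_sqr; apply: ler_wsqrtr.
  have -> : dot (z - x) (z - x) = (a - 1) ^+ 2 * S + (1 - b) ^+ 2 * C.
    rewrite dotE (bigID (mem T)) /= !mulr_sumr; congr (_ + _);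
    by apply: eq_bigr => i iT; rewrite !mxE ?iT ?(negbTE iT); ring.
  apply: le_trans dist _.
  (* With [S^-1 <= n / k] this gives [C / S <= p^2 * (n / k)]. As [n / k >= 1], the factor is
     weakened to its square, which matches the threshold on [gamma]. *)
  have Cp : C <= penalty k x ^+ 2.
    rewrite (penaltyE xT) /C; under eq_bigr do rewrite -(real_normK (num_real _)).
    exact: sumr_sqr_le.
  have Sc : S^-1 <= n%:R / k%:R.
    by rewrite -[leLHS]mul1r ler_pdivrMr // mulrAC ler_pdivlMr // mul1r.
  set c := n%:R / k%:R in c1 Sc *; set p := penalty k x in Cp *.
  have -> : (c * ((1 - b) * p)) ^+ 2 = (1 - b) ^+ 2 * (p ^+ 2 * c ^+ 2) by ring.
  rewrite ler_wpM2l ?sqr_ge0 // ler_pM ?invr_ge0 ?(ltW S0) //.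
  by apply: le_trans Sc _; rewrite expr2 ler_peMl // (le_trans ler01).
Qed.

(** The topology comes from the maximum norm, which the Euclidean norm dominates. *)
Lemma l2norm_lt_nbhs {R : realType} {n : nat} {x : 'cV[R]_n} {U : set 'cV[R]_n} :
  nbhs x U -> exists2 e, 0 < e & forall z, l2norm (z - x) < e -> U z.
Proof.
move=> /nbhs_ballP[e /= e0 xU]; exists e => // z zx; apply: xU.
split=> // i j; rewrite /ball /= ord1 distrC; apply: le_lt_trans zx.
by have := normr_le_l2norm (z - x) i; rewrite 2!mxE.
Qed.

(** With [w = (1 - b) * penalty k x], positive off the k-sparse set, [f] rises by at most
    [(n * L / k) * w] while the penalty term falls by [gamma * w]. *)
Lemma shrink_objective {R : realType} {n k : nat} {f : 'cV[R]_n -> R}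
    {L gamma : R} {x : 'cV[R]_n} {b : R} :
  (1 <= k <= n)%N -> 0 <= L -> euclidean_lipschitz L f ->
  n%:R * L / k%:R < gamma -> unit_sphere R n x ->
  ~~ (l0norm x <= k)%N -> 0 <= b < 1 ->
  exists z, [/\ unit_sphere R n z, penalty k z = b * penalty k x,
    l2norm (z - x) <= n%:R / k%:R * ((1 - b) * penalty k x)
    & objective_Q1 k gamma f z < objective_Q1 k gamma f x].
Proof.
move=> hk L0 lip gam xS xk /andP[b0 b1]; have /andP[_ kn] := hk.
have p0 : 0 < penalty k x by rewrite lt_neqAle penalty_ge0 // eq_sym penalty_eq0 // xk.
have b01 : 0 <= b <= 1 by rewrite b0 ltW.
have [z [zS zp zx]] := shrink_penalty hk xS b01; exists z; split=> //.
have w0 : 0 < (1 - b) * penalty k x by rewrite mulr_gt0 // subr_gt0.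
have fzx : f z - f x <= n%:R * L / k%:R * ((1 - b) * penalty k x).
  apply: le_trans (ler_norm _) _; apply: le_trans (lip z x) _.
  apply: le_trans (ler_wpM2l L0 zx) _.
  by rewrite le_eqVlt; apply/orP; left; apply/eqP; ring.
have gw := gam; rewrite -(ltr_pM2r w0) in gw.
rewrite /objective_Q1 -!/(penalty _ _) zp.
have -> : f x = f x + gamma * ((1 - b) * penalty k x) - gamma * ((1 - b) * penalty k x).
  by rewrite addrK.
lra.
Qed.

Theorem theorem3p7 (R : realType) (n k : nat) (f : 'cV[R]_n -> R)
    (Lf0 Lf gamma : R)
    (hk : (1 <= k <= n)%N)
    (f_smooth : smooth f)
    (Lf0_ge0 : 0 <= Lf0)
    (f_lip : euclidean_lipschitz Lf0 f)
    (Lf_ge0 : 0 <= Lf)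
    (f_descent : quadratic_upper_bound Lf f)
    (gamma_gt0 : 0 < gamma)
    (gamma_large : n%:R * Lf0 / k%:R < gamma) :
  global_minimizers (feasible_Q0 R n k) f
    = global_minimizers (feasible_Q1 R n) (objective_Q1 k gamma f)
  /\ local_minimizers (feasible_Q1 R n) (objective_Q1 k gamma f)
       `<=` local_minimizers (feasible_Q0 R n k) f.
Proof.
have /andP[k1 kn] := hk.
have sparseE x : (l0norm x <= k)%N -> objective_Q1 k gamma f x = f x.
  rewrite -(penalty_eq0 x kn) => /eqP px.
  by rewrite /objective_Q1 -/(penalty k x) px mulr0 addr0.
have shrink x b := @shrink_objective R n k f Lf0 gamma x b hk Lf0_ge0 f_lip gamma_large.
have sparser x : unit_sphere R n x -> ~~ (l0norm x <= k)%N ->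
    exists2 z, feasible_Q0 R n k z & f z < objective_Q1 k gamma f x.
  (* Taking [b = 0] annihilates the penalty, so [z] is k-sparse. *)
  move=> xS xk; have [|z [zS zp _ zx]] := shrink x 0 xS xk; first by rewrite lexx ltr01.
  have zk : (l0norm z <= k)%N by rewrite -(penalty_eq0 z kn) zp mul0r.
  by exists z => //; rewrite -(sparseE z zk).
split.
  apply/seteqP; split=> x [].
    move=> [xS xk] xmin; split=> // y yS; rewrite sparseE //.
    have [yk|yk] := boolP (l0norm y <= k)%N; first by rewrite sparseE //; exact: xmin.
    by have [z zQ zy] := sparser y yS yk; rewrite (le_trans (xmin z zQ)) ?ltW.
  move=> xS xmin; have xk : (l0norm x <= k)%N.
    apply/negPn/negP => xk; have [z [zS zk] zx] := sparser x xS xk.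
    by have := xmin z zS; rewrite (sparseE z zk) leNgt zx.
  split=> // y [yS yk]; by have := xmin y yS; rewrite !sparseE.
move=> x [xS [U xU xmin]]; have xk : (l0norm x <= k)%N.
  apply/negPn/negP => xk; have [e e0 eU] := l2norm_lt_nbhs xU.
  set M := n%:R / k%:R * penalty k x.
  have M0 : 0 <= M by rewrite mulr_ge0 ?penalty_ge0 // divr_ge0.
  (* For [b = 1 - e / (e + M)] the displacement is at most [e * M / (e + M) < e], and [0 <= b < 1]
     holds because [e > 0] and [M >= 0]. *)
  pose d := e + M; have d0 : 0 < d by rewrite /d; lra.
  have t0 : 0 < e / d by exact: divr_gt0.
  have [|z [zS _ zx zlt]] := shrink x (1 - e / d) xS xk.
    rewrite subr_ge0 ler_pdivrMr // mul1r ltrBlDr ltrDl t0 andbT /d; lra.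
  have := xmin z; rewrite leNgt zlt => /(_ _)/negP[] //; split=> //; apply: eU.
  apply: le_lt_trans zx _; rewrite subKr mulrCA -/M mulrAC ltr_pdivrMr //.
  by rewrite ltr_pM2l // /d; lra.
(* The objectives agree on k-sparse points, so the same neighborhood works. *)
split=> //; exists U => // y [[yS yk] yU].
by have := xmin y (conj yS yU); rewrite !sparseE.
Qed.
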